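(* Let $X$ be a completely regular space. Let $H$ be a non-vanishing closed ideal in $C_B(X)$. The following are equivalent: (1) $\mathfrak{sp}(H)$ is Lindelöf. (2) $\mathfrak{sp}(H)$ is $\sigma$-compact. (3) $H=\overline{\langle h\rangle}$ for some $h$ in $H$. (4) For any collection $\{H_i:i\in I\}$ of closed ideals of $C_B(X)$, if $H=\overline{\sum_{i\in I}H_i}$ then $H=\overline{\sum_{j=1}^\infty H_{i_j}}$ for some $i_1,i_2,\ldots$ in $I$. Here the bar denotes the closure in $C_B(X)$.
   Context: Completely regular spaces are assumed Hausdorff. The scalar field $\mathbb{F}$ is fixed and is $\mathbb{R}$ or $\mathbb{C}$. $C_B(X)$ is the Banach algebra of all bounded continuous mappings $X\to\mathbb{F}$ with pointwise addition and multiplication and the supremum norm. $\beta X$ is the Stone–Čech compactification of $X$ (containing $X$ as a dense subspace), and for $f\in C_B(X)$, $f_\beta:\beta X\to\mathbb{F}$ is its unique continuous extension. For $f:Y\to\mathbb{F}$, $\mathrm{coz}(f)=\{y\in Y:f(y)\neq0\}$. An ideal $H$ of $C_B(X)$ is non-vanishing if for every $x\in X$ there is $h\in H$ with $h(x)\neq0$. For a non-vanishing closed ideal $H$ of $C_B(X)$, its spectrum is the subspace $\mathfrak{sp}(H)=\bigcup_{h\in H}\mathrm{coz}(h_\beta)$ of $\beta X$. $\langle h\rangle$ denotes the ideal of $C_B(X)$ generated by $h$. $\sum_{i\in I}H_i$ is the algebraic sum of ideals, i.e. the set of all finite sums of elements of the $H_i$ (likewise for countable index sets). A regular (Hausdorff)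 space is Lindelöf if every open cover has a countable subcover. A Hausdorff space is $\sigma$-compact if it is a countable union of compact subspaces. *)

(* Defs.v *)
From HB Require Import structures.
From mathcomp Require Import all_boot all_order all_algebra.
From mathcomp Require Import complex.
From mathcomp Require Import all_classical all_reals all_analysis.

Set Implicit Arguments.
Unset Strict Implicit.
Unset Printing Implicit Defensive.

Import Order.TTheory GRing.Theory Num.Theory.
Import numFieldNormedType.Exports.

Local Open Scope classical_set_scope.
Local Open Scope ring_scope.

Inductive scalar_kind := real_scalars | complex_scalars.

Definition scalars (R : realType) (k : scalar_kind) : numFieldType :=
  match k with
  | real_scalars => R
  | complex_scalars => R[i]%C
  end.

Section BoundedContinuous.
Context {K : numFieldType} {X : topologicalType}.
Implicit Types (H A : set (X -> K)) (f g h : X -> K).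

Definition CB : set (X -> K) := [set f | continuous f /\ bounded_fun f].

(* Closure in CB for the supremum norm: the inequality holding at every point
   says that the sup norm of f - g is at most eps. *)
Definition CB_closure A : set (X -> K) :=
  [set f | CB f /\ forall eps : K, 0 < eps ->
     exists2 g, A g & forall x, `|f x - g x| <= eps].

(* Stability under scalars follows: constant functions belong to CB. *)
Record ideal H : Prop := Ideal {
  ideal_sub : H `<=` CB;
  ideal0 : H 0;
  idealD : forall f g, H f -> H g -> H (f + g);
  idealM : forall f h, CB f -> H h -> H (f * h)
}.

Definition closed_ideal H := ideal H /\ CB_closure H = H.

Definition nonvanishing H := forall x, exists2 h, H h & h x != 0.

Definition ideal_gen h : set (X -> K) := smallest ideal [set h].

(* Summands may repeat an index; since ideals are stable under addition, this
   gives the same set as sums with one summand for each of finitely many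
   indices. The empty sum 0 is allowed. *)
Definition ideal_sum (I : Type) (Hs : I -> set (X -> K)) : set (X -> K) :=
  [set f | exists n (g : 'I_n -> X -> K),
     (forall j, exists i, Hs i (g j)) /\ f = \sum_(j < n) g j].

End BoundedContinuous.

Definition coz (K : numFieldType) (Y : Type) (f : Y -> K) : set Y :=
  [set y | f y != 0].

(* e : X -> B exhibits B as the Stone-Cech compactification of X: among the
   compactifications of X, the one to which every bounded continuous
   K-valued function extends. *)
Record stone_cech (K : numFieldType) (X B : topologicalType) (e : X -> B) :
    Prop := StoneCech {
  stone_cech_compact : compact [set: B];
  stone_cech_hausdorff : hausdorff_space B;
  stone_cech_inj : injective e;
  stone_cech_continuous : continuous e;
  stone_cech_embedding : forall U : set X, open U ->
    exists2 V : set B, open V & U = e @^-1` V;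
  stone_cech_dense : dense (range e);
  stone_cech_extension : forall f : X -> K, CB f ->
    exists2 fb : B -> K, continuous fb & fb \o e = f
}.

(* The extension is unique when stone_cech K e holds, by density of range e. *)
Definition beta_ext (K : numFieldType) (X B : topologicalType) (e : X -> B)
    (f : X -> K) : B -> K :=
  xget (cst 0) [set fb : B -> K | continuous fb /\ fb \o e = f].

Definition spectrum (K : numFieldType) (X B : topologicalType) (e : X -> B)
    (H : set (X -> K)) : set B :=
  \bigcup_(h in H) coz (beta_ext e h).

(* Covers by open sets of the ambient space, as in cover_compact: equivalent
   to relatively open covers of the subspace A. *)
Definition lindelof (T : topologicalType) (A : set T) :=
  forall U : set (set T), U `<=` open -> A `<=` \bigcup_(V in U) V ->
    exists2 W : set (set T), W `<=` U &
      countable W /\ A `<=` \bigcup_(V in W) V.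

Definition sigma_compact (T : topologicalType) (A : set T) :=
  exists2 C : nat -> set T, (forall n, compact (C n)) & A = \bigcup_n C n.

(* Main.v *)
Require Import Defs.
From HB Require Import structures.
From mathcomp Require Import all_boot all_order all_algebra.
From mathcomp Require Import complex ring lra.
From mathcomp Require Import all_classical all_reals all_analysis.

Set Implicit Arguments.
Unset Strict Implicit.

Import Order.TTheory GRing.Theory Num.Theory.
Import numFieldNormedType.Exports.

Local Open Scope classical_set_scope.
Local Open Scope ring_scope.

(** Write K for the scalar field and B for the Stone-Cech compactification.
    Composition with [e : X -> B] identifies the continuous functions [F] on B
    with the bounded continuous functions [F \o e] on X, preserving all the
    algebra and, by density of the range of [e], all the sup-norm estimates.
    The proofs therefore run on B, with functions of the form [F \o e].

    The heart is the description of the closure of an ideal [J] by its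
    spectrum: [F \o e] lies in the closure of [J] if and only if the cozero set
    of [F] is contained in the spectrum of [J] ([CB_closure_coz] and
    [coz_CB_closure]). For the interesting direction, [F] is at least [r] in
    modulus only on a compact subset of the spectrum, on which compactness
    gives an element [p >= 0] of [J] with [p >= 1] ([nonneg_in_compact]); then
    [F * (p / (t + p))] belongs to [J] and is close to [F] when [t] is small.
    Consequently a closed ideal [H] is the closure of an ideal [J] exactly when
    the two have the same spectrum ([closed_ideal_eq_closure]), and everything
    becomes a statement about open subsets of B: the spectrum of a principal
    ideal is a cozero set, the spectrum of a sum is the union of the spectra,
    and every open set is the spectrum of a closed ideal, by complete
    regularity of B ([spectrum_vanishing_off]).

    The equivalences are then proved in a cycle. If the spectrum of [H] is
    Lindelof, countably many of the open sets where [|F| > 1], with [F \o e] in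
    [H], cover it, and the compact sets where [|F| >= 1] exhaust it. If it is a
    countable union of compact sets [C n], elements of [H] that are positive on
    [C n], rescaled to have values between 0 and 1 and summed with weights
    [1 / 2 ^ n], converge uniformly to an element of [H] whose cozero set is the
    whole spectrum; it generates [H] up to closure. If [H] is the closure both
    of the ideal generated by [h] and of the sum of the [Hs i], approximating
    [h] within [1 / (n + 1)] by finite sums uses only countably many indices in
    all, and the sum of the [Hs i] over these indices has a spectrum that
    already contains the cozero set of [h]. Finally, an open cover of the
    spectrum turns into a family of closed ideals, those of the functions
    vanishing off the trace on the spectrum of a member of the cover, and a
    countable subfamily whose sum has the same closure gives a countable
    subcover. *)

(** * The real and complex scalars treated uniformly *)

Definition of_real {R : realType} (k : scalar_kind) : R -> scalars R k :=
  match k return R -> scalars R k with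
  | real_scalars => fun x => x
  | complex_scalars => fun x => x%:C%C
  end.

Definition modulus {R : realType} {k : scalar_kind} : scalars R k -> R :=
  match k return scalars R k -> R with
  | real_scalars => fun z => `|z|
  | complex_scalars => fun z => complex.Re `|z|
  end.

(** The identity for real scalars, so that [conjugate z * z] is the square of
    the modulus for both fields. *)
Definition conjugate {R : realType} {k : scalar_kind} :
    scalars R k -> scalars R k :=
  match k return scalars R k -> scalars R k with
  | real_scalars => fun z => z
  | complex_scalars => fun z => z^*%C
  end.

Section Scalars.
Context {R : realType} {k : scalar_kind}.
Implicit Types (x y : R) (z w : scalars R k).

Lemma of_realD x y : of_real k (x + y) = of_real k x + of_real k y.
Proof. by case: k => //; exact: rmorphD. Qed.

Lemma of_realM x y : of_real k (x * y) = of_real k x * of_real k y.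
Proof. by case: k => //; exact: rmorphM. Qed.

Lemma of_real0 : of_real k (0 : R) = 0.
Proof. by case: k. Qed.

Lemma of_real1 : of_real k (1 : R) = 1.
Proof. by case: k. Qed.

Lemma of_realN x : of_real k (- x) = - of_real k x.
Proof. by case: k => //; exact: rmorphN. Qed.

Lemma of_real_le x y : (of_real k x <= of_real k y) = (x <= y).
Proof. by case: k => //=; rewrite lecR. Qed.

Lemma of_real_lt x y : (of_real k x < of_real k y) = (x < y).
Proof. by case: k => //=; rewrite ltcR. Qed.

Lemma of_real_modulus z : of_real k (modulus z) = `|z|.
Proof. by case: k z => //= z; rewrite normc_def. Qed.

Lemma conjugate_mul z : conjugate z * z = of_real k (modulus z ^+ 2).
Proof.
rewrite expr2 of_realM of_real_modulus.
case: k z => /= z; first by rewrite -normrM ger0_norm // -expr2 sqr_ge0.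
by rewrite -expr2 sqr_normc mulrC.
Qed.

Lemma normr_conjugateB z w : `|conjugate z - conjugate w| = `|z - w|.
Proof. by case: k z w => //= z w; rewrite -rmorphB normcJ. Qed.

Lemma modulus_le z x : (modulus z <= x) = (`|z| <= of_real k x).
Proof. by rewrite -of_real_modulus of_real_le. Qed.

Lemma modulus_inj z w : `|z| = `|w| -> modulus z = modulus w.
Proof.
rewrite -!of_real_modulus => h; apply/eqP; rewrite eq_le.
by rewrite -!of_real_le h lexx.
Qed.

Lemma modulus_ge0 z : 0 <= modulus z.
Proof. by rewrite -of_real_le of_real0 of_real_modulus. Qed.

Lemma modulus_eq0 z : (modulus z == 0) = (z == 0).
Proof.
rewrite -[RHS]normr_eq0 -of_real_modulus !eq_le.
by rewrite -of_real0 !of_real_le.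
Qed.

Lemma modulus_gt0 z : (0 < modulus z) = (z != 0).
Proof. by rewrite lt_def modulus_eq0 modulus_ge0 andbT. Qed.

Lemma modulusM z w : modulus (z * w) = modulus z * modulus w.
Proof.
apply/eqP; rewrite eq_le -!of_real_le of_realM !of_real_modulus.
by rewrite normrM lexx.
Qed.

Lemma modulusD z w : modulus (z + w) <= modulus z + modulus w.
Proof. by rewrite -of_real_le of_realD !of_real_modulus ler_normD. Qed.

Lemma modulusBC z w : modulus (z - w) = modulus (w - z).
Proof. exact/modulus_inj/distrC. Qed.

Lemma modulus_of_real x : modulus (of_real k x) = `|x|.
Proof. by case: k; rewrite // /modulus normc_def /= expr0n addr0 sqrtr_sqr. Qed.

(** A positive scalar is real even when [k] is complex, which lets the
    tolerances in the scalar field be replaced by real ones. *)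
Lemma of_real_gt0P (eps : scalars R k) :
  0 < eps -> of_real k (modulus eps) = eps.
Proof. by move=> /ltW e0; rewrite of_real_modulus ger0_norm. Qed.

Lemma continuousP_modulus {T : topologicalType} (f : T -> scalars R k) :
  continuous f <->
  forall t r, 0 < r -> \forall s \near t, modulus (f t - f s) < r.
Proof.
split=> [cf t r r0|cf t].
  have /cvgrPdist_lt /(_ (of_real k r)) := cf t.
  rewrite -[0]of_real0 of_real_lt => /(_ r0); apply: filterS => s.
  by rewrite -of_real_modulus of_real_lt.
apply/cvgrPdist_lt => eps e0.
have r0 : 0 < modulus eps by rewrite modulus_gt0 gt_eqF.
apply: filterS (cf t _ r0) => s.
by rewrite -of_real_lt of_real_modulus of_real_gt0P.
Qed.

Lemma continuous_of_real : continuous (@of_real R k).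
Proof.
apply/continuousP_modulus => t r r0.
have /cvgrPdist_lt/(_ r r0) : id x @[x --> t] --> t by exact: cvg_id.
by apply: filterS => s; rewrite -of_realN -of_realD modulus_of_real.
Qed.

Lemma continuous_modulus : continuous (@modulus R k).
Proof.
move=> z; apply/(cvgrPdist_lt (FF := nbhs_filter z)) => r r0.
have /continuousP_modulus/(_ z r r0) : continuous (@id (scalars R k)).
  by move=> ?.
apply: filterS => w; apply: le_lt_trans.
have := modulusD (z - w) w; have := modulusD (w - z) z.
rewrite !subrK modulusBC => h1 h2.
by rewrite ler_norml; apply/andP; split; lra.
Qed.

Lemma continuous_conjugate : continuous (@conjugate R k).
Proof.
apply/continuousP_modulus => z r r0.
have /continuousP_modulus/(_ z r r0) : continuous (@id (scalars R k)).
  by move=> ?.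
by apply: filterS => w; rewrite (modulus_inj (normr_conjugateB _ _)).
Qed.

Lemma CB_closureP {X : topologicalType} (A : set (X -> scalars R k)) f :
  CB_closure A f <-> CB f /\ forall r, 0 < r ->
    exists2 g, A g & forall t, modulus (f t - g t) <= r.
Proof.
split=> -[cf Af].
  split=> // r r0; have e0 : 0 < of_real k r by rewrite -of_real0 of_real_lt.
  by have [g Ag fg] := Af _ e0; exists g => // t; rewrite modulus_le.
split=> // eps e0; have r0 : 0 < modulus eps by rewrite modulus_gt0 gt_eqF.
have [g Ag fg] := Af _ r0; exists g => // t.
by rewrite -(of_real_gt0P e0) -modulus_le.
Qed.
End Scalars.

(** * Real-valued functions *)

Section RealFunctions.
Context {R : realType} {T : topologicalType}.
Implicit Types (u v : T -> R).

Lemma open_superlevel u c : continuous u -> open [set t | c < u t].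
Proof.
move=> cu; apply: (open_comp (D := [set y | c < y])); last exact: open_gt.
by move=> t _; exact: cu.
Qed.

Lemma closed_superlevel u c : continuous u -> closed [set t | c <= u t].
Proof.
move=> cu; apply: (closed_comp (D := [set y | c <= y])); last exact: closed_ge.
by move=> t _; exact: cu.
Qed.

Lemma le_of_dense (A : set T) u v : dense A -> continuous u -> continuous v ->
  (forall t, A t -> u t <= v t) -> forall t, u t <= v t.
Proof.
move=> dA cu cv uv t; rewrite leNgt; apply/negP => vut.
have cuv : continuous (fun s => u s - v s).
  by move=> s; apply: cvgB; [exact: cu|exact: cv].
have [|s [/= us As]] := dA [set s | 0 < u s - v s] _ (open_superlevel 0 cuv).
  by exists t; rewrite /= subr_gt0.
by move: us; rewrite subr_gt0 ltNge uv.
Qed.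

Lemma continuous_uniform_limit u :
  (forall eps, 0 < eps ->
     exists2 v, continuous v & forall t, `|u t - v t| <= eps) ->
  continuous u.
Proof.
move=> uv t; apply/(cvgrPdist_lt (FF := nbhs_filter t)) => r r0.
have r4 : 0 < r / 4 by rewrite divr_gt0.
have [v cv uvr] := uv _ r4.
have /(cvgrPdist_lt (FF := nbhs_filter t))/(_ _ r4) := cv t.
apply: filterS => s vts.
have := uvr t; have := uvr s; move: vts.
rewrite !ler_norml !ltr_norml => /andP[? ?] /andP[? ?] /andP[? ?].
by apply/andP; split; lra.
Qed.
End RealFunctions.

(** * Functions on the compactification and the spectrum of an ideal *)

Section Spectrum.
Context {R : realType} {k : scalar_kind} {X B : topologicalType} {e : X -> B}.
Context (he : stone_cech (scalars R k) e).
Local Notation K := (scalars R k).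
Implicit Types (J : set (X -> K)) (F G : B -> K) (p q : B -> R).

Lemma continuous_modulus_comp F : continuous F ->
  continuous (fun b => modulus (F b)).
Proof.
by move=> cF b; apply: continuous_comp; [exact: cF|exact: continuous_modulus].
Qed.

Lemma modulus_bounded F : continuous F ->
  exists2 M, 0 < M & forall b, modulus (F b) <= M.
Proof.
move=> cF; have /compact_bounded[M [_ MF]] :
    compact ((fun b => modulus (F b)) @` setT).
  apply: continuous_compact; last exact: (stone_cech_compact he).
  exact/continuous_subspaceT/continuous_modulus_comp.
exists (`|M| + 1) => [|b]; first by rewrite ltr_wpDl.
have /MF : M < `|M| + 1 by rewrite (le_lt_trans (ler_norm M)) // ltrDl.
move=> /(_ (modulus (F b))) /=; rewrite ger0_norm ?modulus_ge0 //; apply.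
by exists b.
Qed.

Lemma CB_comp F : continuous F -> CB (F \o e).
Proof.
move=> cF; split.
  move=> x; apply: continuous_comp; last exact: cF.
  exact: (stone_cech_continuous he).
have [M M0 FM] := modulus_bounded cF.
exists (of_real k M); split.
  by rewrite ger0_real // -(@of_real0 R k) of_real_le ltW.
move=> y My x _ /=; apply: le_trans (ltW My).
by rewrite -modulus_le.
Qed.

Lemma le_on_range p q : continuous p -> continuous q ->
  (forall x, p (e x) <= q (e x)) -> forall b, p b <= q b.
Proof.
move=> cp cq pq; apply: (le_of_dense (stone_cech_dense he)) => //.
by move=> _ [x _ <-].
Qed.

Lemma continuous_modulusB F G : continuous F -> continuous G ->
  continuous (fun b => modulus (F b - G b)).
Proof.
move=> cF cG b; apply: (continuous_comp (f := F - G)).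
  2: exact: continuous_modulus.
by apply: continuousB; [exact: cF|exact: cG].
Qed.

Lemma modulus_range_le F G r : continuous F -> continuous G ->
  (forall x, modulus (F (e x) - G (e x)) <= r) ->
  forall b, modulus (F b - G b) <= r.
Proof.
move=> cF cG; apply: (le_on_range (q := fun=> r)); last exact: cst_continuous.
exact: continuous_modulusB.
Qed.

Lemma extension_unique F G : continuous F -> continuous G ->
  F \o e = G \o e -> F = G.
Proof.
move=> cF cG FG; apply/funext => b; apply/eqP; rewrite -subr_eq0 -modulus_eq0.
rewrite eq_le modulus_ge0 andbT; apply: modulus_range_le => // x.
have /= -> := congr1 (@^~ x) FG.
by rewrite subrr -[0]of_real0 modulus_of_real normr0.
Qed.

Lemma beta_ext_comp F : continuous F -> beta_ext e (F \o e) = F.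
Proof.
move=> cF; rewrite /beta_ext; set P := [set _ | _].
have [|cG GF] := @xgetPex _ (cst 0) P; first by exists F.
exact: extension_unique.
Qed.

Lemma CB_extend (f : X -> K) : CB f -> exists2 F, continuous F & F \o e = f.
Proof. exact: stone_cech_extension. Qed.

(** Describing the spectrum by the functions on B that represent elements of
    [J] gets rid of the extension operator. *)
Lemma spectrumP J b : J `<=` CB ->
  spectrum e J b <-> exists F, [/\ continuous F, J (F \o e) & F b != 0].
Proof.
move=> JCB; split=> [[f Jf]|[F [cF JF Fb]]]; last first.
  by exists (F \o e) => //; rewrite /coz /= beta_ext_comp.
have [F cF Ff] := CB_extend (JCB _ Jf).
by rewrite -Ff beta_ext_comp // => Fb; exists F; rewrite Ff.
Qed.

Lemma spectrum_open J : J `<=` CB -> open (spectrum e J).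
Proof.
move=> JCB; rewrite openE => b /(spectrumP _ JCB)[F [cF JF Fb]].
have cm := continuous_modulus_comp cF.
have /open_nbhs_nbhs : open_nbhs b [set c | 0 < modulus (F c)].
  by split; [exact: open_superlevel|rewrite /= modulus_gt0].
apply: filterS => c /=; rewrite modulus_gt0 => Fc.
by apply/spectrumP => //; exists F.
Qed.

(** Elements of [J] taken as real functions on B, so that order and compactness
    arguments apply to them directly. *)
Definition nonneg_in J : set (B -> R) :=
  [set p : B -> R | [/\ continuous p, forall b, 0 <= p b &
            J (fun x => of_real k (p (e x)))]].

Lemma nonneg_in0 J : ideal J -> nonneg_in J (fun=> 0).
Proof.
move=> iJ; split=> [|//|]; first exact: cst_continuous.
rewrite (_ : (fun _ => _) = 0); first exact: ideal0.
by apply/funext => x; rewrite of_real0.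
Qed.

Lemma nonneg_inD J p q : ideal J ->
  nonneg_in J p -> nonneg_in J q -> nonneg_in J (fun b => p b + q b).
Proof.
move=> iJ [cp p0 Jp] [cq q0 Jq]; split.
- by move=> b; apply: cvgD; [exact: cp|exact: cq].
- by move=> b; rewrite addr_ge0.
- rewrite (_ : (fun _ => _) =
    (fun x => of_real k (p (e x))) + (fun x => of_real k (q (e x)))).
    exact: idealD.
  by apply/funext => x; rewrite of_realD.
Qed.

Lemma continuous_of_real_comp p :
  continuous p -> continuous (fun b => of_real k (p b)).
Proof.
by move=> cp b; apply: continuous_comp; [exact: cp|exact: continuous_of_real].
Qed.

Lemma nonneg_inM J p q : ideal J -> continuous p -> (forall b, 0 <= p b) ->
  nonneg_in J q -> nonneg_in J (fun b => p b * q b).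
Proof.
move=> iJ cp p0 [cq q0 Jq]; split.
- by move=> b; apply: cvgM; [exact: cp|exact: cq].
- by move=> b; rewrite mulr_ge0.
- rewrite (_ : (fun _ => _) =
    (fun x => of_real k (p (e x))) * (fun x => of_real k (q (e x)))).
    apply: idealM => //; apply: (CB_comp (F := fun b => of_real k (p b))).
    exact: continuous_of_real_comp.
  by apply/funext => x; rewrite of_realM.
Qed.

(** A multiple of [conjugate F * F], for [F] representing an element of [J] that
    is nonzero at [b]. *)
Lemma nonneg_in_point J b : ideal J -> spectrum e J b ->
  exists2 p, nonneg_in J p & 1 < p b.
Proof.
move=> iJ /(spectrumP _ (ideal_sub iJ))[F [cF JF Fb]].
have m0 : 0 < modulus (F b) ^+ 2 by rewrite exprn_gt0 // modulus_gt0.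
have nF : nonneg_in J (fun b => modulus (F b) ^+ 2).
  split=> [c|c|]; first 2 last.
  - rewrite (_ : (fun _ => _) =
      ((fun b => conjugate (F b)) \o e) * (F \o e)).
      apply: idealM => //; apply: CB_comp => c.
      by apply: continuous_comp; [exact: cF|exact: continuous_conjugate].
    by apply/funext => x; rewrite -conjugate_mul.
  - apply: (continuous_comp (f := fun b => modulus (F b))
                            (g := fun y : R => y ^+ 2)).
    2: exact: exprn_continuous.
    exact: (continuous_modulus_comp cF).
  - exact: sqr_ge0.
exists (fun c => (2 / modulus (F b) ^+ 2) * modulus (F c) ^+ 2).
  apply: (nonneg_inM (p := fun=> _)) => // [|c]; first exact: cst_continuous.
  by rewrite divr_ge0 // ltW.
by rewrite divfK ?gt_eqF // ltr1n.
Qed.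

(** The open sets [p > 1], for [p] a nonnegative element of [J], cover the
    spectrum and form a directed family since such elements can be added;
    hence one of them contains the compact set [C]. *)
Lemma nonneg_in_compact J (C : set B) : ideal J -> compact C ->
  C `<=` spectrum e J -> exists2 p, nonneg_in J p & forall b, C b -> 1 <= p b.
Proof.
move=> iJ /compact_near_coveringP cC CJ.
(* The filter generated by the upper sections of the directed set of
   nonnegative elements of J. *)
pose F : set_system (B -> R) := [set S | exists2 p, nonneg_in J p &
  forall q, nonneg_in J q -> (forall b, p b <= q b) -> S q].
have FF : Filter F.
  split=> [|S S' [p Jp pS] [p' Jp' pS']|S S' SS' [p Jp pS]].
  - by exists (fun=> 0) => //; exact: nonneg_in0.
  - exists (fun b => p b + p' b); first exact: nonneg_inD.
    move=> q Jq pq.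
    split; [apply: pS|apply: pS'] => // b; apply: le_trans (pq b).
      by rewrite lerDl; case: Jp'.
    by rewrite lerDr; case: Jp.
  - by exists p => // q Jq pq; apply/SS'/pS.
have [|p Jp] := cC _ F (fun p b => 1 <= p b) FF.
  move=> b /CJ/(nonneg_in_point iJ)[p Jp pb].
  exists ([set c | 1 < p c], [set q | forall c, p c <= q c]).
    split=> /=; last by exists p.
    apply: open_nbhs_nbhs; split=> //; apply: open_superlevel.
    by case: Jp.
  by move=> [c q] [/= pc /(_ c) pq]; apply: le_trans pq; exact: ltW.
by move=> /(_ p Jp (fun b => lexx _)) Cp; exists p.
Qed.
End Spectrum.

Arguments nonneg_in {R} k {X B} e J.

(** * Closed ideals and open sets of the compactification *)

Section ClosedIdeals.
Context {R : realType} {k : scalar_kind} {X B : topologicalType} {e : X -> B}.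
Context (he : stone_cech (scalars R k) e).
Local Notation K := (scalars R k).
Implicit Types (H J : set (X -> K)) (F G : B -> K) (p q : B -> R) (A : set B).

(** A function of [J] within [|F b| / 2] of [F] cannot vanish at [b]. *)
Lemma CB_closure_coz J F : J `<=` CB -> continuous F ->
  CB_closure J (F \o e) -> coz F `<=` spectrum e J.
Proof.
move=> JCB cF /CB_closureP[_ JF] b; rewrite /coz /= -modulus_gt0 => Fb.
have [g Jg Fg] := JF _ (divr_gt0 Fb (ltr0n R 2)).
have [G cG Gg] := CB_extend he (JCB _ Jg).
apply/(spectrumP he) => //; exists G; rewrite Gg; split => //.
apply/negP => /eqP Gb; have := modulus_range_le he cF cG _ b.
move=> /(_ (modulus (F b) / 2)); rewrite Gb subr0.
have hx x : modulus (F (e x) - G (e x)) <= modulus (F b) / 2.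
  by have := Fg x; rewrite -Gg.
by move=> /(_ hx); lra.
Qed.

(** With [p >= 0] in [J] and [p >= 1] on the compact set [|F| >= r], the
    function [F * (p / (t + p))] is in [J] and differs from [F] by
    [F * (t / (t + p))]. This is at most [t * sup |F|] on that set and less than
    [r] off it. *)
Lemma coz_CB_closure J F : ideal J -> continuous F ->
  coz F `<=` spectrum e J -> CB_closure J (F \o e).
Proof.
move=> iJ cF FJ; apply/CB_closureP; split; first exact: CB_comp.
move=> r r0; have cm := continuous_modulus_comp cF.
have [M M0 FM] := modulus_bounded he cF.
have [] := @nonneg_in_compact _ _ _ _ _ he J [set b | r <= modulus (F b)] iJ.
- apply: (subclosed_compact _ (stone_cech_compact he)) => //.
  exact: closed_superlevel.
- by move=> b /= rF; apply: FJ; rewrite /coz /= -modulus_gt0 (lt_le_trans r0).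
move=> p Jp pC; have [cp p0 _] := Jp.
(* The choice t = r / M makes the bound t * sup |F| at most r. *)
have t0 : 0 < r / M by rewrite divr_gt0.
have tp b : 0 < r / M + p b by rewrite ltr_wpDr.
have [cq q0 Jq] : nonneg_in k e J (fun b => (r / M + p b)^-1 * p b).
  apply: (nonneg_inM he) => // [b|b]; last by rewrite invr_ge0 ltW.
  apply: cvgV; [exact: lt0r_neq0|].
  by apply: cvgD; [exact: cvg_cst|exact: cp].
exists ((F \o e) * (fun x => of_real k ((r / M + p (e x))^-1 * p (e x)))).
  by apply: idealM => //; exact: CB_comp.
move=> x; set b := e x.
change (modulus (F b - F b * of_real k ((r / M + p b)^-1 * p b)) <= r).
have -> : F b - F b * of_real k ((r / M + p b)^-1 * p b) =
          F b * of_real k ((r / M) / (r / M + p b)).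
  rewrite -[X in X - _]mulr1 -mulrBr -of_real1 -of_realN -of_realD.
  congr (_ * of_real k _); move: (r / M) (tp b) => t tpb; field.
  exact: lt0r_neq0.
have s0 : 0 <= (r / M) / (r / M + p b) by rewrite divr_ge0 // ltW.
rewrite modulusM modulus_of_real ger0_norm //.
have [rF|rF] := leP r (modulus (F b)).
  rewrite -[leRHS](divfK (x := M)) ?gt_eqF // mulrC.
  apply: ler_pM => //; first exact: modulus_ge0.
  rewrite ler_pdivrMr //; have := pC b rF => pb.
  by rewrite ler_peMr ?ltW //; lra.
rewrite -[leRHS]mulr1; apply: ler_pM => //; [exact: modulus_ge0|exact: ltW|].
by rewrite ler_pdivrMr // mul1r lerDl.
Qed.

Lemma sub_CB_closure J : J `<=` CB -> J `<=` CB_closure J.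
Proof.
move=> JCB f Jf; split; first exact: JCB.
by move=> eps /ltW eps0; exists f => // x; rewrite subrr normr0.
Qed.

Lemma closed_ideal_mem H F : closed_ideal H -> continuous F ->
  H (F \o e) <-> coz F `<=` spectrum e H.
Proof.
move=> [iH cH] cF; split=> [HF|FH]; last by rewrite -cH; exact: coz_CB_closure.
by apply: CB_closure_coz; [exact: ideal_sub|exact: cF|rewrite cH].
Qed.

(** A closed ideal is determined by its spectrum, and taking the closure of an
    ideal does not change the spectrum. *)
Lemma closed_ideal_eq_closure H J : closed_ideal H -> ideal J ->
  H = CB_closure J <-> spectrum e H = spectrum e J.
Proof.
move=> [iH cH] iJ; split=> [HJ|HJ]; apply/seteqP; split.
- move=> b /(spectrumP he _ (ideal_sub iH))[F [cF]].
  by rewrite HJ => JF; apply: CB_closure_coz JF b => //; exact: ideal_sub.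
- move=> b /(spectrumP he _ (ideal_sub iJ))[F [cF JF Fb]].
  apply/(spectrumP he _ (ideal_sub iH)); exists F; split => //.
  by rewrite HJ; apply: sub_CB_closure => //; exact: ideal_sub.
- move=> f Hf; have [F cF Ff] := CB_extend he (ideal_sub iH Hf).
  move: Hf; rewrite -Ff => /closed_ideal_mem => /(_ (conj iH cH) cF).
  by rewrite HJ; exact: coz_CB_closure.
- move=> f Jf; have [CBf _] := Jf; have [F cF Ff] := CB_extend he CBf.
  move: Jf; rewrite -Ff => /(CB_closure_coz (ideal_sub iJ) cF); rewrite -HJ.
  by move=> ?; apply/closed_ideal_mem.
Qed.

(** The largest ideal whose spectrum is contained in [A]. *)
Definition vanishing_off A : set (X -> K) :=
  [set F \o e | F in [set F : B -> K | continuous F /\ coz F `<=` A]].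

Lemma vanishing_off_ideal A : ideal (vanishing_off A).
Proof.
split.
- by move=> _ [F [cF _] <-]; exact: CB_comp.
- exists 0 => //; split; first exact: cst_continuous.
  by move=> b; rewrite /coz /= eqxx.
- move=> _ _ [F [cF FA] <-] [G [cG GA] <-]; exists (F + G) => //; split.
    by move=> b; apply: continuousD; [exact: cF|exact: cG].
  move=> b; rewrite /coz /= => FGb.
  have [Fb|Fb] := eqVneq (F b) 0; last exact: FA.
  by apply: GA; move: FGb; rewrite fctE Fb add0r.
- move=> f _ CBf [G [cG GA] <-]; have [F cF <-] := CB_extend he CBf.
  exists (F * G) => //; split.
    by move=> b; apply: continuousM; [exact: cF|exact: cG].
  by move=> b; rewrite /coz /= fctE mulf_eq0 negb_or => /andP[_]; exact: GA.
Qed.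

Lemma sub_vanishing_off J A : J `<=` CB ->
  J `<=` vanishing_off A <-> spectrum e J `<=` A.
Proof.
move=> JCB; split=> [JA b|JA f Jf].
  move=> /(spectrumP he _ JCB)[F [cF /JA[G [cG GA] GF]]].
  by rewrite -(extension_unique he cG cF GF); exact: GA.
have [F cF Ff] := CB_extend he (JCB _ Jf).
exists F => //; split=> // b Fb; apply: JA; apply/(spectrumP he) => //.
by exists F; rewrite Ff.
Qed.

Lemma vanishing_off_closed_ideal A : closed_ideal (vanishing_off A).
Proof.
have iA := vanishing_off_ideal A; split=> //; apply/seteqP; split=> f Af.
  have [CBf _] := Af; have [F cF Ff] := CB_extend he CBf.
  exists F => //; split=> //.
  apply: (@subset_trans _ (spectrum e (vanishing_off A))).
    by apply: CB_closure_coz => //; [exact: ideal_sub|rewrite Ff].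
  by apply/sub_vanishing_off => //; exact: ideal_sub.
by apply: sub_CB_closure => //; exact: ideal_sub.
Qed.

(** The compact Hausdorff space B is completely regular: a point of [A] is
    separated from the complement of [A] by a continuous function. *)
Lemma spectrum_vanishing_off A : open A -> spectrum e (vanishing_off A) = A.
Proof.
move=> oA; have iA := vanishing_off_ideal A; apply/seteqP; split.
  by apply/sub_vanishing_off => //; exact: ideal_sub.
move=> b Ab; have hB := stone_cech_hausdorff he.
have nB : normal_space B := compact_normal hB (stone_cech_compact he).
have := normal_completely_regular (R := R) nB (hausdorff_accessible hB).
move=> /(_ b (~` A) (open_closedC oA)) [|uT sep]; first by apply.
have /(uniform_separatorP (R := R))[u [cu _ u0 u1]] :
    uniform_separator [set b] (~` A) by exists uT.
have cv : continuous (fun c => of_real k (1 - u c)).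
  apply: (continuous_of_real_comp (p := fun c => 1 - u c)) => c.
  by apply: cvgB; [exact: cvg_cst|exact: cu].
apply/(spectrumP he _ (ideal_sub iA)).
exists (fun c => of_real k (1 - u c)); split=> //.
  exists (fun c => of_real k (1 - u c)) => //; split=> // c.
  apply: contraPP => Ac.
  rewrite /coz /= (_ : u c = 1) ?subrr ?of_real0 ?eqxx //.
  by apply: u1; exists c.
rewrite (_ : u b = 0) ?subr0 ?of_real1 ?oner_neq0 //.
by apply: u0; exists b.
Qed.

Lemma ideal_gen_ideal (h : X -> K) : CB h -> ideal (ideal_gen h).
Proof.
move=> CBh; split.
- have [F cF Fh] := CB_extend he CBh.
  have iV := vanishing_off_ideal setT.
  apply: subset_trans (ideal_sub iV); apply: smallest_sub => //.
  by move=> _ ->; exists F => //; split.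
- by move=> J [iJ _]; exact: ideal0.
- move=> f g hf hg J hJ; have [iJ _] := hJ; exact: idealD (hf J hJ) (hg J hJ).
- move=> f g CBf hg J hJ; have [iJ _] := hJ; exact: idealM (hg J hJ).
Qed.

Lemma spectrum_ideal_gen F : continuous F ->
  spectrum e (ideal_gen (F \o e)) = coz F.
Proof.
move=> cF; have iF := ideal_gen_ideal (CB_comp he cF); apply/seteqP; split.
  apply/sub_vanishing_off; first exact: ideal_sub.
  apply: smallest_sub; first exact: vanishing_off_ideal.
  by move=> _ ->; exists F => //; split.
move=> b Fb; apply/(spectrumP he _ (ideal_sub iF)); exists F; split=> //.
by move=> J [_]; apply.
Qed.

Lemma ideal_sum_ideal (I : Type) (Hs : I -> set (X -> K)) :
  (forall i, ideal (Hs i)) -> ideal (ideal_sum Hs).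
Proof.
move=> iHs; split.
- move=> _ [n [g [Hg ->]]].
  have iC := vanishing_off_ideal setT.
  apply: (ideal_sub iC); elim/big_ind: _ => [|f f'|j _].
  + exact: ideal0.
  + exact: idealD.
  + have [i Hi] := Hg j; have [G cG <-] := CB_extend he (ideal_sub (iHs i) Hi).
    by exists G.
- by exists 0%N, (fun=> 0); split; [case|rewrite big_ord0].
- move=> _ _ [n [g [Hg ->]]] [m [g' [Hg' ->]]].
  exists (n + m)%N, (fun j =>
    match fintype.split j with inl a => g a | inr b => g' b end).
  split=> [j|]; first by case: (fintype.split j).
  rewrite big_split_ord /=; congr (_ + _); apply: eq_bigr => j _.
    by rewrite (unsplitK (inl j)).
  by rewrite (unsplitK (inr j)).
- move=> f _ CBf [n [g [Hg ->]]]; exists n, (fun j => f * g j).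
  split=> [j|]; last by rewrite mulr_sumr.
  by have [i Hi] := Hg j; exists i; exact: idealM.
Qed.

Lemma spectrum_ideal_sum (I : Type) (Hs : I -> set (X -> K)) :
  (forall i, ideal (Hs i)) ->
  spectrum e (ideal_sum Hs) = \bigcup_i spectrum e (Hs i).
Proof.
move=> iHs; have iS := ideal_sum_ideal iHs; apply/seteqP; split.
  apply/sub_vanishing_off; first exact: ideal_sub.
  have iV := vanishing_off_ideal (\bigcup_i spectrum e (Hs i)).
  move=> _ [n [g [Hg ->]]].
  elim/big_ind: _ => [|f f'|j _]; [exact: ideal0|exact: idealD|].
  have [i Hi] := Hg j.
  have := iffRL (sub_vanishing_off _ (ideal_sub (iHs i))).
  by apply=> [|//] b ib; exists i.
move=> b [i _ /(spectrumP he _ (ideal_sub (iHs i)))[F [cF HF Fb]]].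
apply/(spectrumP he _ (ideal_sub iS)); exists F; split=> //.
exists 1%N, (fun=> F \o e); split; first by exists i.
by rewrite big_ord1.
Qed.
End ClosedIdeals.

Arguments vanishing_off {R} k {X B} e A.

(** * Countability conditions *)

Definition dyadic_sum {R : realType} {T : Type} (v : nat -> T -> R) n t :=
  \sum_(i < n) v i t / 2 ^+ i.

(** The partial sums increase, while the partial sums augmented by the bound
    [2 / 2 ^ n] for the tail decrease; their supremum is squeezed between the
    two. *)
Lemma dyadic_sum_limit {R : realType} {T : Type} (v : nat -> T -> R) :
  (forall n t, 0 <= v n t <= 1) ->
  exists h : T -> R, forall n t,
    dyadic_sum v n t <= h t <= dyadic_sum v n t + 2 / 2 ^+ n.
Proof.
move=> v01; pose S n t := dyadic_sum v n t.
have p2 n : 0 < (2 ^+ n)^-1 :> R by rewrite invr_gt0 exprn_gt0.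
have SS n t : S n.+1 t = S n t + v n t / 2 ^+ n.
  by rewrite /S /dyadic_sum big_ord_recr.
have S_incr m n t : (m <= n)%N -> S m t <= S n t.
  move=> /subnK <-; elim: (n - m)%N => [|d IHd]; first by rewrite add0n.
  apply: le_trans IHd _; rewrite addSn SS lerDl mulr_ge0 ?(ltW (p2 _)) //.
  by case/andP: (v01 (d + m)%N t).
have S_decr m n t : (m <= n)%N -> S n t + 2 / 2 ^+ n <= S m t + 2 / 2 ^+ m.
  move=> /subnK <-; elim: (n - m)%N => [|d IHd]; first by rewrite add0n.
  apply: le_trans IHd; rewrite addSn SS exprS invfM.
  have /andP[v0 v1] := v01 (d + m)%N t; have := p2 (d + m)%N.
  by move: (_^-1) => y y0; nra.
have S_le m n t : S m t <= S n t + 2 / 2 ^+ n.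
  have [/(S_incr _ _ t) Smn|/ltnW/(S_decr _ _ t) Snm] := leqP m n.
    by apply: le_trans Smn _; rewrite lerDl mulr_ge0 ?(ltW (p2 _)).
  by apply: le_trans Snm; rewrite lerDl mulr_ge0 ?(ltW (p2 _)).
exists (fun t => sup (range (S ^~ t))) => n t; apply/andP; split.
  apply: ub_le_sup; last by exists n.
  by exists (S 0%N t + 2 / 2 ^+ 0) => _ [m _ <-].
apply: ge_sup; first by exists (S 0%N t), 0%N.
by move=> _ [m _ <-].
Qed.

Section Equivalences.
Context {R : realType} {k : scalar_kind} {X B : topologicalType} {e : X -> B}.
Context (he : stone_cech (scalars R k) e).
Local Notation K := (scalars R k).
Context {H : set (X -> K)} (hH : closed_ideal H).
Let iH : ideal H := hH.1.
Implicit Types (F G : B -> K) (p q : B -> R) (A : set B).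

(** The open sets [|F| > 1] cover the spectrum because elements of [H] can be
    rescaled, and each lies in the compact subset [|F| >= 1] of the spectrum. *)
Lemma lindelof_sigma_compact_spectrum :
  lindelof (spectrum e H) -> sigma_compact (spectrum e H).
Proof.
pose U := [set V : set B | exists F, [/\ continuous F, H (F \o e) &
  V = [set b | 1 < modulus (F b)]]].
have UC V : U V -> exists C, [/\ compact C, V `<=` C & C `<=` spectrum e H].
  move=> [F [cF HF ->]]; exists [set b | 1 <= modulus (F b)]; split.
  - apply: (subclosed_compact _ (stone_cech_compact he)) => //.
    exact/closed_superlevel/continuous_modulus_comp.
  - by move=> b /ltW.
  - move=> b /= Fb; apply/(spectrumP he _ (ideal_sub iH)); exists F; split=> //.
    by rewrite -modulus_gt0 (lt_le_trans _ Fb).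
move=> /(_ U) [|b /(spectrumP he _ (ideal_sub iH))[F [cF HF Fb]]|W WU].
- by move=> _ [F [cF _ ->]]; exact/open_superlevel/continuous_modulus_comp.
- pose c : K := of_real k (2 / modulus (F b)).
  exists [set x | 1 < modulus (c * F x)].
    exists (fun x => c * F x); split=> //.
      by move=> x; apply: cvgM; [exact: cvg_cst|exact: cF].
    apply: (idealM iH (f := (fun=> c))) => //.
    apply: (CB_comp he (F := fun=> c)); exact: cst_continuous.
  rewrite /= modulusM modulus_of_real ger0_norm ?divr_ge0 ?modulus_ge0 //.
  by rewrite divfK ?ltr1n // modulus_eq0.
move=> [/countable_injP[f f_inj] HW].
(* f numbers the members of the countable subcover; numbers that are not used
   give the empty set. *)
have /choice[C hC] n : exists C, [/\ compact C, C `<=` spectrum e H &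
    forall V, W V -> f V = n -> V `<=` C].
  have [[V [WV fV]]|nV] := pselect (exists V, W V /\ f V = n).
    have [C [cC VC CH]] := UC V (WU _ WV); exists C; split=> // V' WV' fV'.
    by rewrite (f_inj V' V) ?inE // fV fV'.
  exists set0; split=> //; first exact: compact0.
  by move=> V WV fV; case: nV; exists V.
exists C => [n|]; first by case: (hC n).
apply/seteqP; split=> [b /HW[V WV Vb]|b [n _]].
  2: by case: (hC n) => _ + _; apply.
by exists (f V) => //; case: (hC (f V)) => _ _; apply; eauto.
Qed.

(** Elements [p n] of [H] with [p n >= 1] on the [n]-th compact set, replaced by
    [p n / (1 + p n)] to have values between 0 and 1, are summed with weights
    [1 / 2 ^ n]; the uniform limit stays in the closed ideal [H]. *)
Lemma sigma_compact_spectrum_coz : sigma_compact (spectrum e H) ->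
  exists2 F, continuous F /\ H (F \o e) & spectrum e H = coz F.
Proof.
move=> [C cC HC].
have /choice[p hp] n :
    exists p, nonneg_in k e H p /\ forall b, C n b -> 1 <= p b.
  have [|p Hp pC] := nonneg_in_compact he iH (cC n); last by exists p.
  by rewrite HC => b Cb; exists n.
pose v n b := (1 + p n b)^-1 * p n b.
have p0 n b : 0 <= p n b by case: (hp n) => -[].
have p1 n b : 0 < 1 + p n b by rewrite ltr_wpDr.
have v01 n b : 0 <= v n b <= 1.
  rewrite /v mulr_ge0 ?invr_ge0 ?(ltW (p1 _ _)) //=.
  by rewrite mulrC ler_pdivrMr // mul1r lerDr.
have Hv n : nonneg_in k e H (v n).
  apply: (nonneg_inM he) => // [b|b|]; last by case: (hp n).
    apply: cvgV; first exact: lt0r_neq0.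
    by apply: cvgD; [exact: cvg_cst|case: (hp n) => -[cp _ _] _; exact: cp].
  by rewrite invr_ge0 ltW.
have HS n : nonneg_in k e H (dyadic_sum v n).
  elim: n => [|n IHn].
    rewrite (_ : dyadic_sum v 0 = fun=> 0); first exact: nonneg_in0.
    by apply/funext => b; rewrite /dyadic_sum big_ord0.
  rewrite (_ : dyadic_sum v n.+1 =
    fun b => dyadic_sum v n b + (2 ^+ n)^-1 * v n b).
    apply: nonneg_inD => //; apply: (nonneg_inM he (p := fun=> _)) => //.
      exact: cst_continuous.
  apply/funext => b; rewrite /dyadic_sum big_ord_recr /=.
  by congr (_ + _); exact: mulrC.
have [h hS] := dyadic_sum_limit v01.
have hlim eps : 0 < eps -> exists n, forall b, `|h b - dyadic_sum v n b| <= eps.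
  move=> eps0; have eps2 : 0 < eps / 2 by rewrite divr_gt0.
  have [n _ /(_ n (leqnn n)) /= hn] := near_infty_natSinv_expn_lt (PosNum eps2).
  exists n => b; have /andP[h1 h2] := hS n b.
  rewrite ger0_norm ?subr_ge0 // lerBlDl; apply: le_trans h2 _.
  by rewrite lerD2l; move: hn; rewrite mul1r; lra.
have ch : continuous h.
  apply: continuous_uniform_limit => eps /hlim[n hn].
  exists (dyadic_sum v n) => //.
  by case: (HS n).
have cF := continuous_of_real_comp (k := k) ch.
have HF : H (fun x => of_real k (h (e x))).
  rewrite -hH.2; apply/CB_closureP; split; first exact: (CB_comp he cF).
  move=> r /hlim[n hn].
  exists (fun x => of_real k (dyadic_sum v n (e x))).
    by case: (HS n).
  by move=> x; rewrite -of_realN -of_realD modulus_of_real.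
exists (fun b => of_real k (h b)) => //; apply/seteqP; split=> b.
  rewrite HC => -[n _ Cb]; rewrite /coz /= -modulus_gt0 modulus_of_real.
  have /andP[+ _] := hS n.+1 b; rewrite /dyadic_sum big_ord_recr /= => hb.
  rewrite normr_gt0 gt_eqF //; apply: lt_le_trans hb.
  have [_ pb] := hp n; have {}pb := lt_le_trans ltr01 (pb b Cb).
  rewrite ltr_wpDl //; first by case: (HS n) => _ + _; apply.
  by rewrite divr_gt0 ?exprn_gt0 // /v mulr_gt0 // invr_gt0.
move=> Fb; apply/(spectrumP he _ (ideal_sub iH)).
by exists (fun b => of_real k (h b)).
Qed.

Lemma sigma_compact_spectrum_principal : sigma_compact (spectrum e H) ->
  exists2 h, H h & H = CB_closure (ideal_gen h).
Proof.
move=> /sigma_compact_spectrum_coz[F [cF HF] sF]; exists (F \o e) => //.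
have iF := ideal_gen_ideal he (CB_comp he cF).
apply/(closed_ideal_eq_closure he hH iF).
by rewrite spectrum_ideal_gen.
Qed.

Lemma ideal_sum_subfamily (I J : Type) (Hs : I -> set (X -> K)) (s : J -> I) :
  ideal_sum (fun j => Hs (s j)) `<=` ideal_sum Hs.
Proof.
move=> _ [n [g [Hg ->]]]; exists n, g; split=> // j.
by have [i Hi] := Hg j; exists (s i).
Qed.

(** Each [g n] is a finite sum and so involves finitely many indices; all of
    them are enumerated at once along a coding of pairs of integers. *)
Lemma ideal_sum_countable (I : Type) (i0 : I) (Hs : I -> set (X -> K))
  (g : nat -> X -> K) : (forall n, ideal_sum Hs (g n)) ->
  exists s : nat -> I, forall n, ideal_sum (fun j => Hs (s j)) (g n).
Proof.
move=> Hg.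
have /choice[s hs] n : exists s : nat -> I, ideal_sum (fun j => Hs (s j)) (g n).
  have [m [f [/choice[i Hi] ->]]] := Hg n.
  exists (fun j => if insub j is Some j' then i j' else i0), m, f; split=> // j.
  by exists j; rewrite valK.
exists (fun c => let nj := odflt (0, 0)%N (unpickle c) in s nj.1 nj.2) => n.
have [m [f [Hf ->]]] := hs n; exists m, f; split=> // j.
by have [l Hl] := Hf j; exists (pickle (n, l)); rewrite pickleK.
Qed.

(** The generator [h] is a uniform limit of finite sums, and the countably many
    indices that these use already give a sum whose spectrum contains the
    cozero set of [h], which is the spectrum of [H]. *)
Lemma principal_countable_subfamily :
  (exists2 h, H h & H = CB_closure (ideal_gen h)) ->
  forall (I : Type) (Hs : I -> set (X -> K)), inhabited I ->
    (forall i, closed_ideal (Hs i)) -> H = CB_closure (ideal_sum Hs) ->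
    exists i : nat -> I, H = CB_closure (ideal_sum (fun j => Hs (i j))).
Proof.
move=> [h Hh Hgen] I Hs [i0] cHs Hsum.
have [F cF Fh] := CB_extend he (ideal_sub iH Hh).
have sF : spectrum e H = coz F.
  rewrite -(spectrum_ideal_gen he cF) Fh.
  apply/(closed_ideal_eq_closure he hH) => //; apply: (ideal_gen_ideal he).
  exact: ideal_sub Hh.
have iS (J : Type) (s : J -> I) : ideal (ideal_sum (fun j => Hs (s j))).
  by apply: (ideal_sum_ideal he) => j; case: (cHs (s j)).
have /choice[g hg] n : exists g, ideal_sum Hs g /\
    forall x, modulus (h x - g x) <= n.+1%:R^-1.
  move: Hh; rewrite Hsum => /CB_closureP[_].
  by move=> /(_ n.+1%:R^-1) [|g Hg hg]; [rewrite invr_gt0|exists g].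
have [s hs] := ideal_sum_countable i0 (fun n => (hg n).1).
exists s; apply/(closed_ideal_eq_closure he hH (iS _ s)).
have sH : spectrum e H = spectrum e (ideal_sum Hs).
  exact/(closed_ideal_eq_closure he hH (iS _ id)).
apply/seteqP; split.
  rewrite sF; apply: (CB_closure_coz he (ideal_sub (iS _ s)) cF).
  rewrite Fh; apply/CB_closureP; split; first exact: (ideal_sub iH).
  move=> r r0.
  have [n _ /(_ n (leqnn n)) /= hn] := near_infty_natSinv_lt (PosNum r0).
  exists (g n) => // x.
  exact: le_trans ((hg n).2 x) (ltW hn).
rewrite sH; move=> b [f Hf fb]; exists f => //; exact: ideal_sum_subfamily Hf.
Qed.

(** A cover [U] of the spectrum gives the closed ideals [Hs V] of functions
    vanishing off the intersection of [V] with the spectrum; their spectra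
    together make up that of [H]. *)
Lemma countable_subfamily_lindelof :
  (forall (I : Type) (Hs : I -> set (X -> K)), inhabited I ->
    (forall i, closed_ideal (Hs i)) -> H = CB_closure (ideal_sum Hs) ->
    exists i : nat -> I, H = CB_closure (ideal_sum (fun j => Hs (i j)))) ->
  lindelof (spectrum e H).
Proof.
move=> Hcount U Uo HU.
have oH := spectrum_open he (ideal_sub iH).
(* The family is indexed by all sets, A V being empty when V is not in U, so
   that the index type is inhabited even if the cover U is empty. *)
pose A V := [set b | [/\ U V, V b & spectrum e H b]].
have oA V : open (A V).
  have [UV|nUV] := pselect (U V); last first.
    by rewrite (_ : A V = set0); [exact: open0|apply/seteqP; split=> b // []].
  rewrite (_ : A V = V `&` spectrum e H); first exact: openI (Uo _ UV) oH.
  by apply/seteqP; split=> b [].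
pose Hs V : set (X -> K) := vanishing_off k e (A V).
have iHs V : ideal (Hs V) by exact: vanishing_off_ideal.
have spHs I (i : I -> set B) :
    spectrum e (ideal_sum (fun j => Hs (i j))) = \bigcup_j A (i j).
  rewrite (spectrum_ideal_sum he) //; apply: eq_bigcupr => j _.
  exact: spectrum_vanishing_off.
have [||i /(closed_ideal_eq_closure he hH)] := Hcount _ Hs (inhabits set0).
- by move=> V; exact: vanishing_off_closed_ideal.
- apply/(closed_ideal_eq_closure he hH (ideal_sum_ideal he iHs)).
  rewrite (spHs _ id); apply/seteqP; split=> b; last by case=> V _ [].
  by move=> Hb; have [V UV Vb] := HU b Hb; exists V.
rewrite spHs => /(_ (ideal_sum_ideal he (fun j => iHs (i j)))) HE.
exists (U `&` range i); first by move=> V [].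
split; last by rewrite HE => b [j _ [UV Vb _]]; exists (i j).
by apply: sub_countable (card_image_le i setT); apply: subset_card_le => V [].
Qed.
End Equivalences.

Theorem theorem3p8 (R : realType) (k : scalar_kind)
    (X betaX : topologicalType) (e : X -> betaX)
    (H : set (X -> scalars R k)) :
  completely_regular_space X ->
  hausdorff_space X ->
  stone_cech (scalars R k) e ->
  closed_ideal H ->
  nonvanishing H ->
  [<-> lindelof (spectrum e H);
       sigma_compact (spectrum e H);
       exists2 h, H h & H = CB_closure (ideal_gen h);
       forall (I : Type) (Hs : I -> set (X -> scalars R k)),
         inhabited I ->
         (forall i, closed_ideal (Hs i)) ->
         H = CB_closure (ideal_sum Hs) ->
         exists i : nat -> I, H = CB_closure (ideal_sum (fun j => Hs (i j)))].
Proof.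
move=> _ _ he hH _; tfae.
- exact: (lindelof_sigma_compact_spectrum he hH).
- exact: (sigma_compact_spectrum_principal he hH).
- exact: (principal_countable_subfamily he hH).
- exact: (countable_subfamily_lindelof he hH).
Qed.
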